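(* Let $d\in\mathbb{N}$, $R\in(0,\infty]$, and let $\varphi\colon[0,R)\to\mathbb{R}$ be strictly increasing and convex on $[0,R)$. Let $\mathring{B}^{(d)}_R=\{x\in\mathbb{R}^d : |x|<R\}$ (so $\mathring{B}^{(d)}_\infty=\mathbb{R}^d$) and define $\rho\colon \mathring{B}^{(d)}_R\to(0,\infty)$ by $\rho(x)=\exp(-\varphi(|x|))$. Let $U_\rho$ be the simple slice sampling transition kernel of $\rho$. Then for all $x,y\in\mathring{B}^{(d)}_R$, \[ W\big(U_\rho(x,\cdot),U_\rho(y,\cdot)\big)\le\Big(1-\frac{1}{d+1}\Big)\,\big|\,|x|-|y|\,\big|. \]
   Context: $|\cdot|$ is the Euclidean norm and $\lambda_d$ is $d$-dimensional Lebesgue measure. For an unnormalized density $\rho\colon G\to(0,\infty)$ on $G\subseteq\mathbb{R}^d$, the level sets are $G(t)=\{x\in G:\rho(x)\ge t\}$ for $t>0$, $U_t$ denotes the uniform distribution on $G(t)$, i.e. $U_t(A)=\lambda_d(A\cap G(t))/\lambda_d(G(t))$, and the simple slice sampling kernel is $U_\rho(x,A)=\frac{1}{\rho(x)}\int_0^{\rho(x)}U_t(A)\,\mathrm{d}t$ for $x\in G$, $A\in\mathcal{B}(G)$ (one step: draw $t$ uniformly in $[0,\rho(x)]$, then draw the next state uniformly on $G(t)$). For probability measures $\mu,\nu$ on $G$, the Wasserstein distance is $W(\mu,\nu)=\inf_{\gamma}\int_{G\times G}|x-y|\,\mathrm{d}\gamma(x,y)$, the infimum over all couplings $\gamma$ of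 $\mu$ and $\nu$ (measures on $G\times G$ with marginals $\mu$ and $\nu$). *)

(* Defs.v *)
From HB Require Import structures.
From mathcomp Require Import all_boot all_order all_algebra.
From mathcomp Require Import all_classical all_reals all_analysis.
Set Implicit Arguments. Unset Strict Implicit. Unset Printing Implicit Defensive.
Import Order.TTheory GRing.Theory Num.Theory.
Import numFieldNormedType.Exports.
Local Open Scope classical_set_scope.
Local Open Scope ring_scope.

Definition eucl (R : realType) (d : nat) (x : 'rV[R]_d) : R :=
  Num.sqrt (\sum_(i < d) x ord0 i ^+ 2).

(* Borel sigma-algebra of R^d, generated by the open half-spaces {x | x_i < a}. *)
Definition halfspaces (R : realType) (d : nat) : set (set 'rV[R]_d) :=
  [set A | exists (i : 'I_d) (a : R), A = [set x : 'rV[R]_d | x ord0 i < a]].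

Definition Rd (R : realType) (d : nat) := g_sigma_algebraType (@halfspaces R d).

Definition box (R : realType) (d : nat) (a b : 'rV[R]_d) : set 'rV[R]_d :=
  [set x : 'rV[R]_d | forall i : 'I_d, a ord0 i <= x ord0 i <= b ord0 i].
Definition boxvol (R : realType) (d : nat) (a b : 'rV[R]_d) : R :=
  \prod_(i < d) (b ord0 i - a ord0 i).

(* d-dimensional Lebesgue (outer) measure lambda_d: infimum of the total
   volume of countable covers by boxes (a cover is a sequence of boxes,
   each of which may be "unused" (u n = false), so that finite covers are
   also allowed; this matters only for d = 0). *)
Definition lebd (R : realType) (d : nat) (A : set 'rV[R]_d) : \bar R :=
  ereal_inf [set s : \bar R | exists (u : nat -> bool) (a b : nat -> 'rV[R]_d),
     (forall n (i : 'I_d), a n ord0 i <= b n ord0 i) /\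
     A `<=` \bigcup_(n in [set n | u n]) box (a n) (b n) /\
     s = (\sum_(0 <= n <oo) (if u n then (boxvol (a n) (b n))%:E else 0%E))%E].

Definition rho (R : realType) (d : nat) (phi : R -> R) (x : 'rV[R]_d) : R :=
  expR (- phi (eucl x)).

Definition levelset (R : realType) (d : nat) (Rad : \bar R) (phi : R -> R) (t : R)
  : set 'rV[R]_d :=
  [set x : 'rV[R]_d | ((eucl x)%:E < Rad)%E /\ t <= rho phi x].

Definition unif (R : realType) (d : nat) (Rad : \bar R) (phi : R -> R) (t : R)
  (A : set 'rV[R]_d) : \bar R :=
  (lebd (A `&` @levelset R d Rad phi t) * (lebd (@levelset R d Rad phi t))^-1)%E.

Definition slice_kernel (R : realType) (d : nat) (Rad : \bar R) (phi : R -> R)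
  (x : 'rV[R]_d) (A : set 'rV[R]_d) : \bar R :=
  ((rho phi x)^-1%:E *
   \int[lebesgue_measure]_(t in [set t : R | (0 <= t <= rho phi x)%R]) @unif R d Rad phi t A)%E.

Definition coupling (R : realType) (d : nat)
  (mu nu : set 'rV[R]_d -> \bar R) (gamma : probability (Rd R d * Rd R d)%type R) : Prop :=
  forall A : set (Rd R d), measurable A ->
    gamma (A `*` setT) = mu A /\ gamma (setT `*` A) = nu A.

Definition wasserstein (R : realType) (d : nat) (mu nu : set 'rV[R]_d -> \bar R) : \bar R :=
  ereal_inf [set s : \bar R | exists gamma : probability (Rd R d * Rd R d)%type R,
     coupling mu nu gamma /\
     s = (\int[gamma]_z (eucl ((z.1 : 'rV[R]_d) - z.2))%:E)%E].

(* Main.v *)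
Require Import Defs.
From HB Require Import structures.
From mathcomp Require Import all_boot all_order all_algebra.
From mathcomp Require Import all_classical all_reals all_analysis.
From mathcomp Require Import measurable_realfun ring lra.
Set Implicit Arguments. Unset Strict Implicit. Unset Printing Implicit Defensive.
Import Order.TTheory GRing.Theory Num.Theory.
Import numFieldNormedType.Exports.
Local Open Scope classical_set_scope.
Local Open Scope ring_scope.

(** Write G_a(c) for the radius of the level set {rho >= exp (- phi a - c)}, that is
    the supremum of the q with phi q <= phi a + c. Let u be uniform on (0,1) and let V
    be uniform on the unit ball, independent of u. Since Lebesgue measure scales
    homogeneously, G_|x|(- ln u) V has law U_rho(x, .), so using the same u and V for
    x and y gives a coupling whose cost is E|V| times the mean of
    |G_|x|(- ln u) - G_|y|(- ln u)|. As phi is convex and increasing, its increments of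
    a given length grow to the right, hence a |-> G_a(c) is 1-Lipschitz; and
    P(|V| <= s) = s^d gives E|V| = 1 - 1/(d+1). *)

(** * Lebesgue outer measure from countable box covers *)

Section box_outer_measure.
Context (R : realType) (d : nat).
Implicit Types (A : set 'rV[R]_d) (u : nat -> bool) (a b : nat -> 'rV[R]_d).
Local Open Scope ereal_scope.

Definition box_cover A u a b :=
  (forall n (i : 'I_d), (a n ord0 i <= b n ord0 i)%R) /\
  A `<=` \bigcup_(n in [set n | u n]) box (a n) (b n).

Definition cover_term u a b (n : nat) : \bar R :=
  if u n then (boxvol (a n) (b n))%:E else 0.

Lemma boxvol_ge0 (p q : 'rV[R]_d) :
  (forall i : 'I_d, (p ord0 i <= q ord0 i)%R) -> (0 <= boxvol p q)%R.
Proof. by move=> pq; apply: prodr_ge0 => i _; rewrite subr_ge0. Qed.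

Lemma cover_term_ge0 A u a b n : box_cover A u a b -> 0 <= cover_term u a b n.
Proof.
by move=> [ab _]; rewrite /cover_term; case: ifPn => // _; rewrite lee_fin boxvol_ge0.
Qed.

Lemma lebd_le_cover A u a b : box_cover A u a b ->
  lebd A <= \sum_(0 <= n <oo) cover_term u a b n.
Proof. by move=> [ab Aab]; apply: ereal_inf_lbound; exists u, a, b. Qed.

Lemma lebd_ge (l : \bar R) A :
  (forall u a b, box_cover A u a b -> l <= \sum_(0 <= n <oo) cover_term u a b n) ->
  l <= lebd A.
Proof.
by move=> lA; apply: le_ereal_inf_tmp => _ [u [a [b [ab [Aab ->]]]]]; exact: lA.
Qed.

Lemma lebd_ge0 A : 0 <= lebd A.
Proof.
by apply: lebd_ge => u a b c; apply: nneseries_ge0 => n _ _; exact: cover_term_ge0 c.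
Qed.

Lemma lebd_cover_adherent A (e : R) : (0 < e)%R -> lebd A != +oo ->
  exists u a b, box_cover A u a b /\
    \sum_(0 <= n <oo) cover_term u a b n <= lebd A + e%:E.
Proof.
move=> e0 Aoo; have lA0 := lebd_ge0 A.
have /(lb_ereal_inf_adherent e0) : lebd A \is a fin_num.
  by rewrite ge0_fin_numE// ltey.
move=> [x [u [a [b [ab [Aab ->]]]]] xlt]; exists u, a, b; split => //.
exact: ltW.
Qed.

Lemma lebd0 : lebd (set0 : set 'rV[R]_d) = 0.
Proof.
apply/eqP; rewrite eq_le lebd_ge0 andbT.
have c : box_cover set0 (fun=> false) (fun=> 0%R : 'rV[R]_d) (fun=> 0%R) by split.
by apply: (le_trans (lebd_le_cover c)); rewrite eseries0.
Qed.

Lemma le_lebd : {homo @lebd R d : A B / A `<=` B >-> A <= B}.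
Proof.
move=> A B AB; apply: lebd_ge => u a b [ab Bab]; apply: lebd_le_cover.
by split => //; exact: subset_trans Bab.
Qed.

(** If some [A i] has infinite measure, the series is infinite. Otherwise choose for each [A n] a
    cover that is optimal up to [e / 2 ^ n.+1] and pool all these covers into one cover of the
    union; the errors add up to at most [e]. *)
Lemma lebd_sigma_subadditive : sigma_subadditive (@lebd R d).
Proof.
move=> A; have [[i ioo]|] := pselect (exists i, lebd (A i) = +oo).
  rewrite (eseries_pinfty _ _ ioo) ?leey// => n _.
  by rewrite -ltNye (lt_le_trans _ (lebd_ge0 _)).
rewrite -forallNE => Aoo.
apply/lee_addgt0Pr => e e0.
rewrite (le_trans _ (epsilon_trick _ _ (ltW e0)))//; last first.
  by move=> n; exact: lebd_ge0.
pose P n (c : (nat -> bool) * (nat -> 'rV[R]_d) * (nat -> 'rV[R]_d)) :=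
  box_cover (A n) c.1.1 c.1.2 c.2 /\
  \sum_(0 <= k <oo) cover_term c.1.1 c.1.2 c.2 k <=
    lebd (A n) + (e / (2 ^ n.+1)%:R)%:E.
have [G PG] : {G & forall n, P n (G n)}.
  apply: (@choice _ _ P) => n.
  have [||u [a [b ?]]] := @lebd_cover_adherent (A n) (e / (2 ^ n.+1)%:R).
  - by rewrite divr_gt0// ltr0n expn_gt0.
  - exact/eqP/Aoo.
  - by exists (u, a, b).
pose t (p : nat * nat) := cover_term (G p.1).1.1 (G p.1).1.2 (G p.1).2 p.2.
have t_ge0 p : 0 <= t p by exact: cover_term_ge0 (PG p.1).1.
apply: (@le_trans _ _ (\esum_(p in setT) t p)).
  (* A bijection [f] from the naturals to pairs lists the pooled boxes as one sequence; box [j] of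
     cover [i] is found at index [f^-1 (i, j)]. *)
  have /card_esym/ppcard_eqP[f] := card_nat2.
  pose U k := (G (f k).1).1.1 (f k).2.
  pose a k := (G (f k).1).1.2 (f k).2.
  pose b k := (G (f k).1).2 (f k).2.
  have -> : \esum_(p in setT) t p = \sum_(0 <= k <oo) cover_term U a b k.
    transitivity (\sum_(0 <= k <oo) (t \o f) k); last by [].
    rewrite nneseries_esumT; last by move=> n; exact: t_ge0.
    by rewrite (reindex_esum setT setT f)//.
  apply: lebd_le_cover; split.
    by move=> n i; exact: (PG (f n).1).1.1.
  move=> x [i _ /(PG i).1.2 [j /= uj xj]].
  exists (f^-1%FUN (i, j)); rewrite /= /U /a /b invK ?inE//.
(* Splitting the pairs into the rows [J i] turns the unordered sum into an iterated series, each row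
   of which is bounded by the choice of [G]. *)
rewrite (_ : esum _ _ = \sum_(0 <= i <oo) \sum_(0 <= j <oo) t (i, j)); last first.
  pose J : nat -> set (nat * nat) := fun i => [set (i, j) | j in setT].
  rewrite (_ : setT = \bigcup_k J k); last first.
    by rewrite predeqE => -[p q]; split => // _; exists p => //; exists q.
  rewrite esum_bigcupT//=; last first.
    apply/trivIsetP => i j _ _ ij.
    rewrite predeqE => -[n m] /=; split => //= -[] [_] _ [<-{n} _].
    by move=> [m' _] [] /esym/eqP; rewrite (negbTE ij).
  rewrite -nneseries_esumT//; last by move=> n; exact: esum_ge0.
  apply: eq_eseriesr => /= j _.
  rewrite nneseries_esumT// (reindex_esum setT _ (pair j))//.
  split => //; first by move=> n _; exists n.
  by move=> ? ? _ _ [].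
by apply: lee_nneseries => n *; [apply: nneseries_ge0 => *; exact: t_ge0|exact: (PG n).2].
Qed.

HB.instance Definition _ := isOuterMeasure.Build R 'rV[R]_d (@lebd R d)
  lebd0 lebd_ge0 le_lebd lebd_sigma_subadditive.

End box_outer_measure.

(** * Carathéodory measurability of Borel sets *)

Section lebd_caratheodory.
Context (R : realType) (d : nat).
Local Open Scope ereal_scope.

(* The cut position t is clamped to the i-th side, so that cutting always gives two
   boxes, one of them possibly flat. *)
Definition box_cut_max (i : 'I_d) (t : R) (a b : 'rV[R]_d) : 'rV[R]_d :=
  \row_j (if j == i then Num.max (a ord0 i) (Num.min (b ord0 i) t) else b ord0 j)%R.
Definition box_cut_min (i : 'I_d) (t : R) (a b : 'rV[R]_d) : 'rV[R]_d :=
  \row_j (if j == i then Num.min (b ord0 i) (Num.max (a ord0 i) t) else a ord0 j)%R.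

(** Since [a <= b], the two clamped cut positions coincide, so the [i]-th side splits into two
    adjacent intervals while all other factors are common. *)
Lemma boxvol_cut (i : 'I_d) (t : R) (a b : 'rV[R]_d) :
  (forall j, a ord0 j <= b ord0 j)%R ->
  (boxvol a (box_cut_max i t a b) + boxvol (box_cut_min i t a b) b = boxvol a b)%R.
Proof.
move=> ab; rewrite /boxvol (bigD1 i)//= [X in (_ + X)%R](bigD1 i)//= [RHS](bigD1 i)//=.
rewrite !mxE eqxx.
under eq_bigr => j /negbTE ji do rewrite mxE ji.
under [X in (_ + _ * X)%R]eq_bigr => j /negbTE ji do rewrite mxE ji.
rewrite -mulrDl; congr (_ * _)%R.
have abi := ab i; rewrite /Num.min /Num.max.
by case: (ltP (b ord0 i) t) => ?; case: (ltP (a ord0 i) t) => ?;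
  repeat (case: ifPn; rewrite -?leNgt => ?); lra.
Qed.

(** Cutting each box of a cover of [X] at [t] gives covers of the two parts of [X], with the same
    total volume by [boxvol_cut]. *)
Lemma halfspace_caratheodory (i : 'I_d) (t : R) :
  (@lebd R d).-caratheodory [set x : 'rV[R]_d | (x ord0 i < t)%R].
Proof.
apply: le_caratheodory_measurable => X; apply: lebd_ge => u a b c.
have [ab Xab] := c.
pose b1 n := box_cut_max i t (a n) (b n).
pose a2 n := box_cut_min i t (a n) (b n).
have ab1 n j : (a n ord0 j <= b1 n ord0 j)%R.
  by rewrite mxE; case: eqP => [->|_]; rewrite ?le_max ?lexx.
have a2b n j : (a2 n ord0 j <= b n ord0 j)%R.
  by rewrite mxE; case: eqP => [->|_]; rewrite ?ge_min ?lexx.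
have c1 : box_cover (X `&` [set x | (x ord0 i < t)%R]) u a b1.
  split=> // x [/Xab[n /= un xn] /= xt]; exists n => // j.
  have /andP[-> xb] := xn j; rewrite mxE; case: eqP xb => [->|//] xb.
  by rewrite le_max le_min xb (ltW xt) orbT.
have c2 : box_cover (X `&` ~` [set x | (x ord0 i < t)%R]) u a2 b.
  split=> // x [/Xab[n /= un xn] /= /negP]; rewrite -leNgt => xt; exists n => // j.
  have /andP[xa ->] := xn j; rewrite mxE andbT; case: eqP xa => [->|//] xa.
  by rewrite ge_min ge_max xt xa orbT.
apply: (le_trans (leeD (lebd_le_cover c1) (lebd_le_cover c2))).
rewrite -nneseriesD; last 2 first.
- by move=> n _ _; exact: cover_term_ge0 c1.
- by move=> n _ _; exact: cover_term_ge0 c2.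
apply: lee_nneseries => n *.
  by rewrite adde_ge0//; [exact: cover_term_ge0 c1|exact: cover_term_ge0 c2].
rewrite /cover_term; case: ifPn => _; last by rewrite adde0.
by rewrite -EFinD lee_fin boxvol_cut.
Qed.

(** The Carathéodory measurable sets form a sigma-algebra, and it contains the generating
    half-spaces. *)
Lemma Rd_caratheodory (A : set (Rd R d)) : measurable A -> (@lebd R d).-caratheodory A.
Proof.
move=> mA.
apply: (@smallest_sub _ _ (@halfspaces R d) (@lebd R d).-caratheodory) mA.
  exact: (@sigma_algebra_measurable _ (caratheodory_type (@lebd R d))).
by move=> _ [i [t ->]]; exact: halfspace_caratheodory.
Qed.

(** A copy of [lebd] on the Borel space [Rd], so that it can carry a measure structure next to the
    outer measure structure of [lebd]. *)
Definition lebRd (A : set (Rd R d)) : \bar R := lebd A.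

Let lebRd0 : lebRd set0 = 0. Proof. exact: lebd0. Qed.
Let lebRd_ge0 A : 0 <= lebRd A. Proof. exact: lebd_ge0. Qed.
Let lebRd_sigma_additive : semi_sigma_additive lebRd.
Proof.
move=> F mF tF mUF.
apply: (@caratheodory_measure_sigma_additive R _ (@lebd R d) F) => //.
- by move=> i; exact: Rd_caratheodory.
- exact: Rd_caratheodory.
Qed.

HB.instance Definition _ := isMeasure.Build _ (Rd R d) R lebRd
  lebRd0 lebRd_ge0 lebRd_sigma_additive.

End lebd_caratheodory.

(** * Homogeneity under dilations, and a volume bound for covers of a cube *)

Section lebd_scaling.
Context (R : realType) (d : nat).
Local Open Scope ereal_scope.

(** Dividing all corners of a cover of [A] by [c] covers the preimage, and each box volume is
    divided by [c ^+ d]. *)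
Let lebd_scale_le (c : R) (A : set 'rV[R]_d) : (0 < c)%R ->
  (c ^+ d)%:E * lebd ((fun x => c *: x)%R @^-1` A) <= lebd A.
Proof.
move=> c0; apply: lebd_ge => u a b cov; have [ab Aab] := cov.
have cV0 : (0 < c^-1)%R by rewrite invr_gt0.
pose a' n := (c^-1 *: a n)%R; pose b' n := (c^-1 *: b n)%R.
have cov' : box_cover ((fun x => c *: x)%R @^-1` A) u a' b'.
  split=> [n i|x /= /Aab[n /= un xn]].
    by rewrite !mxE ler_pM2l.
  exists n => // i; have := xn i; rewrite !mxE => /andP[ax xb].
  by rewrite mulrC ler_pdivrMr// mulrC ax/= mulrC ler_pdivlMr// mulrC.
have cd0 : (0 < c ^+ d)%R by rewrite exprn_gt0.
have -> : \sum_(0 <= n <oo) cover_term u a b n =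
    (c ^+ d)%:E * \sum_(0 <= n <oo) cover_term u a' b' n.
  rewrite -nneseriesZl; last by move=> n _; exact: cover_term_ge0 cov'.
  apply: eq_eseriesr => n _; rewrite /cover_term; case: ifPn => _; last by rewrite mule0.
  rewrite -EFinM; congr EFin; rewrite /boxvol.
  under [in RHS]eq_bigr do rewrite !mxE -mulrBr.
  by rewrite big_split/= prodr_const card_ord mulrA -exprMn divff ?gt_eqF// expr1n mul1r.
by rewrite lee_pmul2l ?lte_fin//; exact: lebd_le_cover.
Qed.

(** The converse inequality is the first one, applied to the preimage with factor [c^-1]. *)
Lemma lebd_scale (c : R) (A : set 'rV[R]_d) : (0 < c)%R ->
  (c ^+ d)%:E * lebd ((fun x => c *: x)%R @^-1` A) = lebd A.
Proof.
move=> c0; apply/eqP; rewrite eq_le lebd_scale_le//=.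
have cV0 : (0 < c^-1)%R by rewrite invr_gt0.
have := lebd_scale_le ((fun x => c *: x)%R @^-1` A) cV0.
rewrite -comp_preimage (_ : _ \o _ = id); last first.
  by apply/funext => x /=; rewrite scalerA divff ?gt_eqF// scale1r.
rewrite preimage_id -(@lee_pmul2l _ (c ^+ d)%:E) ?lte_fin ?exprn_gt0//.
by rewrite muleA -EFinM -exprMn divff ?gt_eqF// expr1n mul1e.
Qed.

End lebd_scaling.

(* Induction on d: for each first coordinate y, the boxes whose first side contains y
   cover the (d-1)-dimensional cube; integrate the resulting bound over y. *)
Lemma cube_cover_le (R : realType) (s : R) (d : nat) : 0 <= s ->
  forall (u : nat -> bool) (a b : nat -> nat -> R),
  (forall n i, (i < d)%N -> a n i <= b n i) ->
  (forall x : nat -> R, (forall i, (i < d)%N -> 0 <= x i <= s) ->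
    exists2 n, u n & forall i, (i < d)%N -> a n i <= x i <= b n i) ->
  ((s ^+ d)%:E <= \sum_(0 <= n <oo)
     (if u n then (\prod_(i < d) (b n i - a n i))%:E else 0))%E.
Proof.
move=> s0; elim: d => [|d IH] u a b ab cov.
  (* In dimension 0 the single point forces some box to be used, and its volume is the empty product
     1. *)
  have [//|n un _] := cov (fun=> 0).
  rewrite (nneseriesD1 (n := n))//; last first.
    by move=> k _; case: ifPn => // _; rewrite big_ord0.
  rewrite un big_ord0 leeDl//; apply: nneseries_ge0 => k _ _.
  by case: ifPn => // _; rewrite big_ord0.
(* [V n] is the volume of box [n] without its first side; the sum of the [f n y] below is thus the
   total volume of the slices at first coordinate [y]. *)
pose V n := \prod_(i < d) (b n i.+1 - a n i.+1).
have V0 n : 0 <= V n by apply: prodr_ge0 => i _; rewrite subr_ge0 ab// ltnS.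
pose w n : R := if u n then V n else 0.
have w0 n : 0 <= w n by rewrite /w; case: ifPn.
pose f (n : nat) (y : R) := ((w n)%:E * (\1_(`[a n 0%N, b n 0%N]) y)%:E)%E.
have f0 n y : (0 <= f n y)%E by rewrite mule_ge0 ?lee_fin.
have mf n : measurable_fun `[0, s] (f n).
  apply: measurable_funTS; apply: emeasurable_funM => //.
  exact/measurable_EFinP/measurable_indic.
have step (y : R) : 0 <= y <= s -> ((s ^+ d)%:E <= \sum_(0 <= n <oo) f n y)%E.
  move=> y0s.
  apply: (le_trans (IH (fun n => u n && (a n 0%N <= y <= b n 0%N))
    (fun n i => a n i.+1) (fun n i => b n i.+1) _ _)).
  - by move=> n i id; exact: ab.
  - move=> x x0s; have [|n un xn] := cov (fun i => if i is j.+1 then x j else y).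
      by case=> //= i; rewrite ltnS; exact: x0s.
    exists n; first by rewrite un; exact: (xn 0%N).
    by move=> i id; exact: (xn i.+1).
  apply: lee_nneseries => n *.
    by case: ifPn => // _; rewrite lee_fin; exact: V0.
  rewrite /f /w indicE mem_setE in_itv/=.
  by case: (u n) => /=; rewrite ?mul0e//; case: ifPn => _; rewrite ?mule1 ?mule0.
have -> : (s ^+ d.+1)%:E = (\int[lebesgue_measure]_(y in `[0%R, s]) (s ^+ d)%:E)%E.
  rewrite integral_cst//= lebesgue_measure_itv/= lte_fin.
  have [s1|] := ltP 0 s; first by rewrite -EFinD -EFinM subr0 exprSr.
  move=> s1; have -> : s = 0 by apply/eqP; rewrite eq_le s0 s1.
  by rewrite expr0n mule0.
apply: (@le_trans _ _ (\int[lebesgue_measure]_(y in `[0%R, s]) \sum_(0 <= n <oo) f n y)%E).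
  apply: ge0_le_integral => //=.
  - by move=> *; rewrite lee_fin exprn_ge0.
  - by apply: (@ge0_emeasurable_sum _ _ _ _ f xpredT).
rewrite integral_nneseries//; apply: lee_nneseries => n *.
  by apply: integral_ge0.
rewrite ge0_integralZl ?lee_fin//; last first.
  by apply/measurable_EFinP; exact: measurable_indic.
rewrite integral_indic//.
have := ab n 0%N isT; rewrite big_ord_recl -/(V n) => ab0.
have lab : lebesgue_measure (`[a n 0%N, b n 0%N] : set R) = (b n 0%N - a n 0%N)%:E.
  rewrite lebesgue_measure_itv/= lte_fin; case: ltgtP ab0 => // ->.
  by rewrite subrr.
rewrite /w; case: ifPn => _; last by rewrite mul0e.
rewrite EFinM muleC lee_pmul ?lee_fin//.
by rewrite -lab; apply: le_measure; rewrite ?inE//=; exact: measurableI.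
Qed.

(** * Volumes of Euclidean balls *)

Section euclidean_balls.
Context (R : realType) (d : nat).
Implicit Types x : 'rV[R]_d.

Definition eball (r : R) : set 'rV[R]_d := [set x | eucl x < r].
Definition ecball (r : R) : set 'rV[R]_d := [set x | eucl x <= r].

Lemma eucl_ge0 x : 0 <= eucl x.
Proof. exact: sqrtr_ge0. Qed.

Lemma euclZ (c : R) x : eucl (c *: x) = `|c| * eucl x.
Proof.
rewrite /eucl -sqrtr_sqr -sqrtrM ?sqr_ge0//; congr Num.sqrt.
by rewrite mulr_sumr; apply: eq_bigr => i _; rewrite mxE exprMn.
Qed.

Lemma le_coord_eucl x (i : 'I_d) : `|x ord0 i| <= eucl x.
Proof.
rewrite -sqrtr_sqr /eucl ler_wsqrtr// (bigD1 i)//= lerDl.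
by apply: sumr_ge0 => j _; rewrite sqr_ge0.
Qed.

Lemma eballZ (c r : R) : 0 < c ->
  (fun x => c *: x) @^-1` eball (c * r) = eball r.
Proof.
by move=> c0; apply/seteqP; split=> x; rewrite /eball/= euclZ gtr0_norm// ltr_pM2l.
Qed.

Lemma ecballZ (c r : R) : 0 < c ->
  (fun x => c *: x) @^-1` ecball (c * r) = ecball r.
Proof.
by move=> c0; apply/seteqP; split=> x; rewrite /ecball/= euclZ gtr0_norm// ler_pM2l.
Qed.

Lemma lebd_eball (r : R) : 0 < r -> lebd (eball r) = ((r ^+ d)%:E * lebd (eball 1))%E.
Proof. by move=> r0; rewrite -(lebd_scale (eball r) r0) -[in RHS](eballZ 1 r0) mulr1. Qed.

Lemma lebd_ecball (r : R) : 0 < r -> lebd (ecball r) = ((r ^+ d)%:E * lebd (ecball 1))%E.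
Proof. by move=> r0; rewrite -(lebd_scale (ecball r) r0) -[in RHS](ecballZ 1 r0) mulr1. Qed.

Lemma lebd_box_le (a b : 'rV[R]_d) : (forall i, a ord0 i <= b ord0 i) ->
  (lebd (box a b) <= (boxvol a b)%:E)%E.
Proof.
move=> ab.
have c : box_cover (box a b) (fun n => n == 0%N) (fun=> a) (fun=> b).
  by split=> // x xab; exists 0%N.
apply: (le_trans (lebd_le_cover c)).
rewrite (nneseriesD1 (n := 0%N))//; last by move=> k _; exact: cover_term_ge0 c.
rewrite [X in (_ + X)%E]eseries0 ?adde0// => k _ /andP[_ /negbTE k0].
by rewrite /cover_term k0.
Qed.

Lemma lebd_eball1_lty : (lebd (eball 1) < +oo)%E.
Proof.
apply: (@le_lt_trans _ _ (boxvol (const_mx (-1)) (const_mx 1 : 'rV[R]_d))%:E); last exact: ltry.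
apply: (le_trans _ (lebd_box_le _)) => [|i]; last by rewrite !mxE; lra.
apply: le_lebd => x /= x1 i; rewrite !mxE -ler_norml.
exact: (le_trans (le_coord_eucl x i) (ltW x1)).
Qed.

(** The cube with sides [[0, s]], [s = 1/(d+1)], lies in the open unit ball because [d * s^2 < 1];
    so any cover of the ball covers this cube and has volume at least [s ^+ d]. *)
Lemma lebd_eball1_gt0 : (0 < lebd (eball 1))%E.
Proof.
pose s : R := d.+1%:R^-1.
have s0 : 0 < s by rewrite invr_gt0 ltr0n.
apply: (@lt_le_trans _ _ (s ^+ d)%:E); first by rewrite lte_fin exprn_gt0.
apply: lebd_ge => u a b [ab cov].
(* [cube_cover_le] takes coordinates indexed by the naturals, so row vectors are extended by 0. *)
pose co (v : 'rV[R]_d) (i : nat) := if insub i is Some j then v ord0 j else 0.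
have coE v (i : 'I_d) : co v i = v ord0 i by rewrite /co valK.
apply: (le_trans (@cube_cover_le R s d (ltW s0) u
  (fun n => co (a n)) (fun n => co (b n)) _ _)).
- by move=> n i id; rewrite -[i]/(val (Ordinal id)) !coE.
- move=> x xs; pose v : 'rV[R]_d := \row_(i < d) x i.
  have [|n /= un vn] := cov v.
    rewrite /eball/= -[ltRHS]sqrtr1 ltr_sqrt// /v.
    apply: (@le_lt_trans _ _ (\sum_(i < d) s ^+ 2)).
      apply: ler_sum => i _; rewrite mxE.
      have /andP[x0 x1] := xs i (ltn_ord i).
      by rewrite lerXn2r// nnegrE ltW.
    rewrite sumr_const card_ord -mulr_natl /s expr2 mulrA.
    rewrite -[ltRHS](mulfV (x := d.+1%:R)) ?pnatr_eq0//.
    rewrite ltr_pM2r ?invr_gt0 ?ltr0n// ltr_pdivrMr ?ltr0n//.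
    by rewrite -natrM ltr_nat mulnS ltn_addr.
  exists n => // i id; have := vn (Ordinal id); rewrite mxE/=.
  by rewrite -[i]/(val (Ordinal id)) !coE.
apply: lee_nneseries => n *.
  case: ifPn => // _; rewrite lee_fin prodr_ge0// => i _.
  by rewrite !coE subr_ge0.
rewrite /cover_term; case: ifPn => // _; rewrite lee_fin /boxvol.
by under eq_bigr do rewrite !coE.
Qed.

(** For every [t > 1] the closed ball lies in the open ball of radius [t], of volume [t ^+ d * v];
    let [t] decrease to 1. *)
Lemma lebd_ecball1 : lebd (ecball 1) = lebd (eball 1).
Proof.
apply/eqP; rewrite eq_le; apply/andP; split; last first.
  by apply: le_lebd => x /= /ltW.
have fin1 : lebd (eball 1) \is a fin_num by rewrite ge0_fin_numE ?lebd_ge0 ?lebd_eball1_lty.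
have l0 := lebd_eball1_gt0.
rewrite -(fineK fin1) in l0 *; set v := fine _ in l0 *.
have bnd (t : R) : 1 < t -> (lebd (ecball 1) <= (t ^+ d * v)%:E)%E.
  move=> t1; have t0 : 0 < t by lra.
  rewrite EFinM /v fineK// -lebd_eball//; apply: le_lebd => x /= x1.
  exact: le_lt_trans t1.
have finc : lebd (ecball 1) \is a fin_num.
  rewrite ge0_fin_numE ?lebd_ge0//; apply: le_lt_trans (bnd 2 _) _; first by lra.
  exact: ltry.
rewrite -(fineK finc) in bnd *; rewrite lee_fin.
have : t ^+ d * v @[t --> (1 : R)^'+] --> 1 ^+ d * v.
  by apply: cvg_at_right_filter; apply: cvgMr_tmp; exact: exprn_continuous.
rewrite expr1n mul1r => /cvgr_to_ge; apply.
near=> t; rewrite -lee_fin; apply: bnd.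
by near: t; exact: nbhs_right_gt.
Unshelve. all: by end_near. Qed.

End euclidean_balls.

(** * Radii of level sets: boundedness, positivity, Lipschitz dependence *)

Section slice_radius.
Context (R : realType) (Rad : \bar R) (phi : R -> R).
Hypothesis Rad_gt0 : (0 < Rad)%E.
Hypothesis phi_incr : forall s t : R, 0 <= s -> s < t -> (t%:E < Rad)%E -> phi s < phi t.
Hypothesis phi_conv : forall s t l : R,
  0 <= s -> (s%:E < Rad)%E -> 0 <= t -> (t%:E < Rad)%E ->
  0 <= l <= 1 -> phi (l * s + (1 - l) * t) <= l * phi s + (1 - l) * phi t.

Definition sublevel (a c : R) : set R :=
  [set q | [/\ 0 <= q, (q%:E < Rad)%E & phi q <= phi a + Num.max c 0]].

(* The radius of the level set [rho >= exp (- phi a - c)]; truncating c at 0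
   makes the estimates below hold for every real c. *)
Definition slice_radius (a c : R) : R := sup (sublevel a c).

Let le_phi (s t : R) : 0 <= s -> s <= t -> (t%:E < Rad)%E -> phi s <= phi t.
Proof.
move=> s0; rewrite le_eqVlt => /predU1P[->//|st] tR; exact/ltW/phi_incr.
Qed.

Let exists_radius : exists2 s : R, 0 < s & (s%:E < Rad)%E.
Proof.
case: Rad Rad_gt0 => [r| |]// r0; last by exists 1; rewrite ?ltry.
by rewrite lte_fin in r0; exists (r / 2); rewrite ?lte_fin; lra.
Qed.

Lemma sublevel_self (a c : R) : 0 <= a -> (a%:E < Rad)%E -> sublevel a c a.
Proof. by move=> a0 aR; split => //; rewrite lerDl le_max lexx orbT. Qed.

(** A finite [Rad] is itself a bound. If [Rad] is infinite, convexity and [phi 0 < phi 1] force at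
    least linear growth of [phi]. *)
Lemma sublevel_has_ubound (a c : R) : has_ubound (sublevel a c).
Proof.
have [[r RadE]|Rady] : (exists r, Rad = r%:E) \/ Rad = +oo%E.
  by case: Rad Rad_gt0 => [r| |]//= _; [left; exists r|right].
  by exists r => q [_ + _]; rewrite RadE lte_fin => /ltW.
have lty (t : R) : (t%:E < Rad)%E by rewrite Rady ltry.
set K := phi a + Num.max c 0.
have k0 : 0 < phi 1 - phi 0 by rewrite subr_gt0 phi_incr.
(* For [q > 1], writing 1 as a convex combination of [q] and 0 gives
   [q * (phi 1 - phi 0) <= phi q - phi 0]. *)
exists (Num.max 1 ((K - phi 0) / (phi 1 - phi 0))) => q [q0 _ qK].
rewrite le_max; have [//|q1/=] := leP q 1.
rewrite ler_pdivlMr//.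
have q0' : 0 < q by lra.
have := @phi_conv q 0 q^-1 q0 (lty _) (lexx _) (lty _).
rewrite mulVf ?gt_eqF// mulr0 addr0 => /(_ _) h.
have {h} h : phi 1 <= q^-1 * phi q + (1 - q^-1) * phi 0.
  by apply: h; rewrite invr_ge0 q0/= invf_le1// ltW.
have : q * phi 1 <= phi q + (q - 1) * phi 0.
  have -> : phi q + (q - 1) * phi 0 = q * (q^-1 * phi q + (1 - q^-1) * phi 0).
    by field; rewrite gt_eqF.
  by rewrite ler_pM2l.
by rewrite -/K in qK; nra.
Qed.

Lemma le_slice_radius (a c q : R) : sublevel a c q -> q <= slice_radius a c.
Proof. by move=> aq; apply: ub_le_sup => //; exact: sublevel_has_ubound. Qed.

Lemma slice_radius_le_ub (a c K : R) : 0 <= a -> (a%:E < Rad)%E ->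
  (forall q, sublevel a c q -> q <= K) -> slice_radius a c <= K.
Proof.
move=> a0 aR ub; apply: ge_sup => //; exists a; exact: sublevel_self.
Qed.

(** Monotonicity of [phi] makes the sublevel set an interval starting at 0, so it contains
    everything below its supremum. *)
Lemma lt_slice_radius (a c q : R) : 0 <= a -> (a%:E < Rad)%E ->
  0 <= q -> q < slice_radius a c -> sublevel a c q.
Proof.
move=> a0 aR q0 qr.
have [|q' [q'0 q'R q'K] qq'] := sup_gt _ qr.
  by exists a; exact: sublevel_self.
split=> //.
  by apply: le_lt_trans q'R; rewrite lee_fin ltW.
by apply: le_trans q'K; apply: le_phi => //; exact: ltW.
Qed.

(** The delicate case is [a = 0], where convexity excludes an upward jump of [phi] at 0: on [[0, s]]
    the graph lies below its chord, and [l] is chosen so that the chord has risen by at most [c] at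
    [l * s]. *)
Lemma slice_radius_gt0 (a c : R) : 0 <= a -> (a%:E < Rad)%E -> 0 < c ->
  0 < slice_radius a c.
Proof.
move=> a0 aR c0; have [s s0 sR] := exists_radius.
have k0 : 0 < phi s - phi 0 by rewrite subr_gt0 phi_incr.
pose l := Num.min 1 (c / (phi s - phi 0)).
have l0 : 0 < l by rewrite lt_min ltr01 divr_gt0.
have l1 : l <= 1 by rewrite ge_min lexx.
have lc : l * (phi s - phi 0) <= c.
  by rewrite -ler_pdivlMr// ge_min lexx orbT.
have ls0 : 0 < l * s by rewrite mulr_gt0.
apply: (lt_le_trans ls0); apply: le_slice_radius; split.
- exact: ltW.
- by apply: le_lt_trans sR; rewrite lee_fin ler_piMl// ltW.
have := @phi_conv s 0 l (ltW s0) sR (lexx _) Rad_gt0.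
rewrite mulr0 addr0 (ltW l0) l1 => /(_ isT) h.
have := @le_phi 0 a (lexx _) a0 aR.
have : c <= Num.max c 0 by rewrite le_max lexx.
by nra.
Qed.

Lemma slice_radius_homo (a : R) : 0 <= a -> (a%:E < Rad)%E ->
  {homo slice_radius a : c c' / c <= c'}.
Proof.
move=> a0 aR c c' cc'; apply: slice_radius_le_ub => // q [q0 qR qK].
apply: le_slice_radius; split => //; apply: (le_trans qK).
by rewrite lerD2l ge_max !le_max cc' lexx orbT.
Qed.

(** The points [b] and [q - (b - a)] are mirror images in [[a, q]], hence convex combinations of [a]
    and [q] with exchanged weights [l] and [1 - l]; add the two convexity inequalities. *)
Let phi_increment (a b q : R) : 0 <= a -> a <= b -> b < q -> (q%:E < Rad)%E ->
  phi b + phi (q - (b - a)) <= phi a + phi q.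
Proof.
move=> a0 ab bq qR.
have qa : 0 < q - a by lra.
have aR : (a%:E < Rad)%E by apply: lt_trans qR; rewrite lte_fin; lra.
have q0 : 0 <= q by lra.
pose l := (q - b) / (q - a).
have l01 : 0 <= l <= 1.
  by rewrite /l divr_ge0 ?ler_pdivrMr//=; lra.
have l01' : 0 <= 1 - l <= 1 by lra.
have := @phi_conv a q l a0 aR q0 qR l01.
have := @phi_conv a q (1 - l) a0 aR q0 qR l01'.
have -> : l * a + (1 - l) * q = b by rewrite /l; field; rewrite gt_eqF.
have -> : (1 - l) * a + (1 - (1 - l)) * q = q - (b - a).
  by rewrite /l; field; rewrite gt_eqF.
by nra.
Qed.

(** For [a <= b] the radius grows with the base point because [phi] does. Conversely, a point
    [q > b] of the sublevel set of [b], moved left by [b - a], lies in that of [a] by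
    [phi_increment]; a point [q <= b] exceeds [a], itself in the sublevel set of [a], by at most
    [b - a]. *)
Lemma slice_radius_lipschitz (a b c : R) :
  0 <= a -> (a%:E < Rad)%E -> 0 <= b -> (b%:E < Rad)%E ->
  `|slice_radius a c - slice_radius b c| <= `|a - b|.
Proof.
wlog ab : a b / a <= b => [H|] a0 aR b0 bR.
  have [ab|/ltW ba] := leP a b; first exact: H.
  by rewrite distrC [leRHS]distrC; exact: H.
have h1 : slice_radius a c <= slice_radius b c.
  apply: slice_radius_le_ub => // q [q0 qR qK]; apply: le_slice_radius; split => //.
  by apply: (le_trans qK); rewrite lerD2r; exact: le_phi.
rewrite distrC ger0_norm ?subr_ge0// distrC ger0_norm ?subr_ge0// lerBlDl.
apply: slice_radius_le_ub => // q [q0 qR qK].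
have ar : a <= slice_radius a c by apply: le_slice_radius; exact: sublevel_self.
have [qb|bq] := leP q b; first by lra.
suff : q - (b - a) <= slice_radius a c by lra.
have := phi_increment a0 ab bq qR => h.
apply: le_slice_radius; split; [lra| |lra].
by apply: le_lt_trans qR; rewrite lee_fin; lra.
Qed.

End slice_radius.

(** * Measurability of coordinates, norm and balls; spheres are null sets *)

Section Rd_measurability.
Context (R : realType) (d : nat).

Lemma measurable_coord (i : 'I_d) :
  measurable_fun [set: Rd R d] (fun x : Rd R d => (x : 'rV[R]_d) ord0 i).
Proof.
apply: (measurability (@RGenInftyO.G R)); first exact: RGenInftyO.measurableE.
move=> _ [_ [t ->] <-]; rewrite setTI; apply: sub_sigma_algebra.
by exists i, t; apply/seteqP; split=> x; rewrite /= in_itv.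
Qed.

Lemma measurable_fun_Rd (dT : measure_display) (T : measurableType dT) (f : T -> Rd R d) :
  (forall i, measurable_fun [set: T] (fun t => (f t : 'rV[R]_d) ord0 i)) ->
  measurable_fun [set: T] f.
Proof.
move=> mf; apply: (@measurability _ _ T (Rd R d) setT f (@halfspaces R d) erefl).
move=> _ [_ [i [t ->]] <-].
have := mf i measurableT _ (measurable_itv `]-oo, t[).
by congr measurable; apply/seteqP; split=> x /= [_]; rewrite in_itv.
Qed.

Lemma measurable_eucl : measurable_fun [set: Rd R d] (@eucl R d : Rd R d -> R).
Proof.
have msqrt : measurable_fun [set: R] (@Num.sqrt R).
  by apply: nondecreasing_measurable => // s t; exact: ler_wsqrtr.
apply: (measurableT_comp msqrt); apply: measurable_sum => i.
by apply: measurable_funX; exact: measurable_coord.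
Qed.

Lemma measurable_eball (r : R) : measurable (eball r : set (Rd R d)).
Proof.
have := measurable_eucl measurableT (measurable_itv `]-oo, r[).
by congr measurable; apply/seteqP; split=> x /=; rewrite in_itv//= => -[].
Qed.

Lemma measurable_ecball (r : R) : measurable (ecball r : set (Rd R d)).
Proof.
have := measurable_eucl measurableT (measurable_itv `]-oo, r]).
by congr measurable; apply/seteqP; split=> x /=; rewrite in_itv//= => -[].
Qed.

(** By scaling, the open and closed balls have the same finite volume. This allows level sets to be
    replaced by open balls. *)
Lemma lebd_sphere (r : R) : 0 < r -> lebd (ecball r `\` @eball R d r) = 0%E.
Proof.
move=> r0.
have fin : lebd (@eball R d r) \is a fin_num.
  rewrite ge0_fin_numE ?lebd_ge0// lebd_eball// lte_mul_pinfty ?lee_fin ?exprn_ge0// ?ltW//.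
  exact: lebd_eball1_lty.
have E : lebd (@ecball R d r) = lebd (@eball R d r).
  by rewrite lebd_ecball// lebd_ecball1 -lebd_eball.
have sub : @eball R d r `<=` ecball r by move=> x /= /ltW.
have fin' : (lebd (@ecball R d r) < +oo)%E by rewrite E -ge0_fin_numE ?lebd_ge0.
have -> : lebd (ecball r `\` @eball R d r) =
    (lebd (@ecball R d r) - lebd (ecball r `&` @eball R d r))%E.
  exact: (@measureD _ (Rd R d) R (@lebRd R d) _ _ (measurable_ecball r) (measurable_eball r)).
by rewrite (setIidr sub) E subee.
Qed.

End Rd_measurability.

(** * The uniform distribution on the unit ball and its mean norm *)

Section ball_probability.
Context (R : realType) (d : nat).
Local Open Scope ereal_scope.

Let vol : R := fine (lebd (@eball R d 1)).

Lemma ball_volE : lebd (@eball R d 1) = vol%:E.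
Proof. by rewrite fineK// ge0_fin_numE ?lebd_ge0 ?lebd_eball1_lty. Qed.

Lemma ball_vol_gt0 : (0 < vol)%R.
Proof. by rewrite -lte_fin -ball_volE lebd_eball1_gt0. Qed.

Let volV_ge0 : (0 <= vol^-1)%R.
Proof. by rewrite invr_ge0 ltW// ball_vol_gt0. Qed.

Definition ball_prob : set (Rd R d) -> \bar R :=
  mscale (NngNum volV_ge0) (mrestr (@lebRd R d) (@measurable_eball R d 1)).

HB.instance Definition _ := Measure.on ball_prob.

Lemma ball_probE (A : set (Rd R d)) :
  ball_prob A = (vol^-1)%:E * lebd (A `&` @eball R d 1).
Proof. by []. Qed.

Let ball_probT : ball_prob setT = 1.
Proof.
by rewrite ball_probE setTI ball_volE -EFinM mulVf// gt_eqF// ball_vol_gt0.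
Qed.

HB.instance Definition _ := Measure_isProbability.Build _ _ _ ball_prob ball_probT.

Lemma ball_prob_ecball (r : R) : (0 < r < 1)%R -> ball_prob (ecball r) = (r ^+ d)%:E.
Proof.
move=> /andP[r0 r1]; rewrite ball_probE setIidl; last first.
  by move=> x /= xr; exact: le_lt_trans r1.
rewrite lebd_ecball// lebd_ecball1 ball_volE -!EFinM; congr EFin.
by rewrite mulrCA mulVf ?mulr1// gt_eqF// ball_vol_gt0.
Qed.

Lemma integral_one_sub_exprn :
  \int[lebesgue_measure]_(r in `[0%R, 1%R]) (1 - r ^+ d)%:E = (1 - (d.+1%:R)^-1 : R)%:E.
Proof.
pose F (x : R) := (x - x ^+ d.+1 * d.+1%:R^-1)%R.
have dX (x : R) : derivable (fun y : R => y ^+ d.+1 * d.+1%:R^-1)%R x 1.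
  by apply: derivableM => //; exact: exprn_derivable.
have dF (x : R) : derivable F x 1 by apply: derivableB => //; exact: dX.
have cF (x : R) : {for x, continuous F}.
  by apply: differentiable_continuous; exact/derivable1_diffP.
rewrite (@continuous_FTC2 _ _ F)//=.
- by rewrite /F expr1n mul1r expr0n/= mul0r subr0 sube0.
- apply: continuous_in_subspaceT => x _; apply: cvgB; first exact: cvg_cst.
  exact: exprn_continuous.
- split=> [x _|  |]; first exact: dF.
  + exact/cvg_at_right_filter/cF.
  + exact/cvg_at_left_filter/cF.
- move=> x _; rewrite derive1E deriveB//.
  rewrite -!derive1E derive1_id derive1Mr; last exact: exprn_derivable.
  by rewrite exp_derive1/= -mulr_algl [(_%:A)%R]mulr1 mulrAC divff ?mul1r// pnatr_eq0.
Qed.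

(** The mean of |V| is the integral over [r >= 0] of P(|V| > r), which equals [1 - r ^+ d] for
    [0 < r < 1] and vanishes for [r > 1]. *)
Lemma integral_ball_prob_eucl :
  \int[ball_prob]_v (eucl (v : 'rV[R]_d))%:E <= (1 - (d.+1%:R)^-1 : R)%:E.
Proof.
pose X : {RV ball_prob >-> R} :=
  HB.pack (@eucl R d : Rd R d -> R) (isMeasurableFun.Build _ _ _ _ _ (@measurable_eucl R d)).
have := @ge0_expectation_ccdf _ _ _ ball_prob X (@eucl_ge0 R d).
rewrite expectation_def => ->.
have -> : `[0%R, +oo[%classic = `[0%R, 1%R]%classic `|` `]1%R, +oo[%classic :> set R.
  apply/seteqP; split=> [r|r []] /=; rewrite !in_itv/= ?andbT; [|lra..].
  by move=> r0; case: (leP r 1%R) => r1; [left; rewrite r0|right].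
have mX := ccdf_measurable X.
rewrite ge0_integral_setU//; last 2 first.
- exact: measurable_funTS mX.
- by apply/disj_setPS => r [] /=; rewrite !in_itv/= andbT; lra.
rewrite [X in _ + X]integral0_eq ?adde0; last first.
  move=> r /=; rewrite in_itv/= andbT => r1.
  rewrite /ccdf /distribution /pushforward/= ball_probE (_ : _ `&` _ = set0) ?lebd0 ?mule0//.
  by apply/seteqP; split=> // v [] /=; rewrite in_itv/= andbT /eball/=; lra.
(* Endpoints are dropped since [ball_prob_ecball] requires [0 < r < 1]. *)
rewrite integral_itv_bndoo; last exact: measurable_funTS mX.
rewrite -integral_one_sub_exprn integral_itv_bndoo; last first.
  apply/measurable_EFinP; apply: measurable_funB => //; exact: measurable_funX.
apply: ge0_le_integral => //=.
- exact: measurable_funTS mX.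
- apply/measurable_EFinP; apply: measurable_funB => //; exact: measurable_funX.
move=> r; rewrite in_itv/= => r01.
have cdfE : cdf X r = (r ^+ d)%:E.
  by rewrite -(ball_prob_ecball r01) /cdf /distribution /pushforward; congr (ball_prob _).
by rewrite -[leLHS]/(ccdf X r) ccdf_1_cdf cdfE.
Qed.

End ball_probability.

(** * Change of scale in integrals on the line *)

Lemma lebesgue_measure_dilate (R : realType) (k : R) (k0 : 0 < k) (A : set R) :
  measurable A ->
  pushforward lebesgue_measure (fun t : R => t / k : measurableTypeR R) A =
  (k%:E * lebesgue_measure A)%E.
Proof.
move=> mA.
have mk : measurable_fun [set: R] (fun t : R => t / k : measurableTypeR R).
  exact: measurable_funM.
have kV0 : 0 <= k^-1 by rewrite invr_ge0 ltW.
pose m : {measure set (measurableTypeR R) -> \bar R} :=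
  measure_function_pushforward__canonical__measure_function_Measure lebesgue_measure mk.
(* By uniqueness of Lebesgue measure, it suffices that [k^-1] times the pushforward gives half-open
   intervals their length. *)
rewrite (@lebesgue_measure_unique R (mscale (NngNum kV0) m) _ A mA) /mscale/=.
  by rewrite muleA -EFinM divff ?mul1e// gt_eqF.
move=> _ [[a b] /= _ <-].
rewrite /mscale/= /pushforward lebesgue_measure_itv/= lte_fin.
have -> : (fun t : R => t / k) @^-1` `]a, b] = `]a * k, b * k]%classic.
  by apply/seteqP; split=> t; rewrite /= !in_itv/= ltr_pdivlMr// ler_pdivrMr.
rewrite lebesgue_measure_itv/= lte_fin ltr_pM2r//.
case: ifPn => _; last by rewrite mule0.
by rewrite -!EFinD -EFinM -mulrBl mulrC mulfK// gt_eqF.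
Qed.

Lemma ge0_integral_dilate (R : realType) (k : R) (f : R -> \bar R) : 0 < k ->
  measurable_fun `]0%R : R, 1%R[ f -> (forall u, 0 <= f u)%E ->
  (\int[lebesgue_measure]_(t in `]0%R, k[) f (t / k)%R =
   k%:E * \int[lebesgue_measure]_(u in `]0%R, 1%R[) f u)%E.
Proof.
move=> k0 mf f0.
have mk : measurable_fun [set: measurableTypeR R] (fun t : R => t / k : measurableTypeR R).
  exact: measurable_funM.
have := @ge0_integral_pushforward _ _ _ _ R _ mk lebesgue_measure `]0, 1[%classic f
  (measurable_itv _) mf (fun u _ => f0 u).
have -> : (fun t : R => t / k) @^-1` `]0, 1[ = `]0, k[%classic.
  by apply/seteqP; split=> t; rewrite /= !in_itv/= ltr_pdivlMr// ltr_pdivrMr// mul0r mul1r.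
move=> <-.
rewrite -(@ge0_integral_mscale _ _ _ lebesgue_measure _ (measurable_itv _) (NngNum (ltW k0)) f)//.
by apply: eq_measure_integral => A mA _; exact: lebesgue_measure_dilate.
Qed.

(** * Products of probability measures *)

Section product_probability.
Context (d1 d2 : measure_display) (T1 : measurableType d1) (T2 : measurableType d2)
  (R : realType) (P1 : probability T1 R) (P2 : probability T2 R).
Local Open Scope ereal_scope.

Definition prod_prob : set (T1 * T2) -> \bar R := P1 \x P2.

HB.instance Definition _ := Measure.on prod_prob.

Let prod_probT : prod_prob setT = 1.
Proof.
rewrite -setXTT [LHS]product_measure1E//.
by rewrite [X in X * _](probability_setT P1) [X in _ * X](probability_setT P2) mule1.
Qed.

HB.instance Definition _ := Measure_isProbability.Build _ _ _ prod_prob prod_probT.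

End product_probability.

(** * The slice kernel as the law of a randomly scaled uniform point of the ball *)

Section slice_marginal.
Context (R : realType) (d : nat) (Rad : \bar R) (phi : R -> R).
Hypothesis Rad_gt0 : (0 < Rad)%E.
Hypothesis phi_incr : forall s t : R, 0 <= s -> s < t -> (t%:E < Rad)%E -> phi s < phi t.
Hypothesis phi_conv : forall s t l : R,
  0 <= s -> (s%:E < Rad)%E -> 0 <= t -> (t%:E < Rad)%E ->
  0 <= l <= 1 -> phi (l * s + (1 - l) * t) <= l * phi s + (1 - l) * phi t.
Variable x : 'rV[R]_d.
Hypothesis hx : ((eucl x)%:E < Rad)%E.

(** Here [u] is the height relative to [rho phi x]: the level [u * rho phi x] allows [phi] to exceed
    [phi (eucl x)] by [- ln u]. *)
Let r (u : R) : R := slice_radius Rad phi (eucl x) (- ln u).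

Let x0 : 0 <= eucl x. Proof. exact: eucl_ge0. Qed.

Lemma measurable_slice_radius_ln : measurable_fun [set: R] r.
Proof.
apply: (@measurableT_comp _ _ _ _ _ _ (slice_radius Rad phi (eucl x)) _ (fun u => - ln u)).
  by apply: nondecreasing_measurable => //; exact: slice_radius_homo.
by apply: measurableT_comp => //; exact: measurable_ln.
Qed.

Lemma measurable_slice_point :
  measurable_fun [set: R * Rd R d] (fun p : R * Rd R d => r p.1 *: (p.2 : 'rV[R]_d) : Rd R d).
Proof.
apply: measurable_fun_Rd => i.
rewrite (_ : (fun t => _) = (fun p : R * Rd R d => r p.1 * (p.2 : 'rV[R]_d) ord0 i)); last first.
  by apply/funext => p; rewrite mxE.
apply: measurable_funM.
  by apply: measurableT_comp measurable_slice_radius_ln _.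
exact: (measurableT_comp (@measurable_coord R d i)).
Qed.

(** Compare logarithms. The supremum defining [r u] need not be attained, so the level set is only
    enclosed between the open and the closed ball. *)
Lemma levelset_eball (u : R) : 0 < u < 1 ->
  eball (r u) `<=` @levelset R d Rad phi (u * rho phi x) /\
  @levelset R d Rad phi (u * rho phi x) `<=` ecball (r u).
Proof.
move=> /andP[u0 u1].
have lnu : 0 < - ln u by rewrite oppr_gt0 ln_lt0// u0.
have key (z : 'rV[R]_d) : (u * rho phi x <= rho phi z) =
    (phi (eucl z) <= phi (eucl x) + Num.max (- ln u) 0).
  rewrite /rho -{1}(lnK (x := u)) ?posrE// -expRD ler_expR.
  by rewrite (max_l (ltW lnu)); apply/idP/idP; lra.
split=> z.
  move=> zr; have [] := lt_slice_radius phi_incr x0 hx (eucl_ge0 z) zr.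
  by move=> _ zR zK; split => //; rewrite key.
move=> [zR]; rewrite key => zK.
by apply: le_slice_radius => //; split => //; exact: eucl_ge0.
Qed.

(** The level set differs from the open ball of radius [r u] by a subset of a null sphere; after
    rescaling to the unit ball the factors [r u ^+ d] cancel. *)
Lemma unif_ball_prob (u : R) (A : set (Rd R d)) : 0 < u < 1 -> measurable A ->
  @unif R d Rad phi (u * rho phi x) A =
  @ball_prob R d [set v | A (r u *: (v : 'rV[R]_d))].
Proof.
move=> u01 mA; have [sub1 sub2] := levelset_eball u01.
have r0 : 0 < r u.
  apply: slice_radius_gt0 => //.
  by have /andP[u0 u1] := u01; rewrite oppr_gt0 ln_lt0// u0.
rewrite /unif; set L := levelset _ _ _ in sub1 sub2 *.
have LE : lebd L = ((r u ^+ d)%:E * lebd (@eball R d 1))%E.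
  apply/eqP; rewrite eq_le -{2}lebd_eball// le_lebd// andbT.
  by rewrite -lebd_ecball1 -lebd_ecball// le_lebd.
have ALE : lebd (A `&` L) = lebd (A `&` @eball R d (r u)).
  apply/eqP; rewrite eq_le; apply/andP; split; last by apply: le_lebd; exact: setIS.
  apply: (@le_trans _ _ (lebd ((A `&` @eball R d (r u)) `|` (ecball (r u) `\` @eball R d (r u))))).
    apply: le_lebd => z [Az Lz]; have [zr|zr] := ltP (eucl z) (r u); first by left.
    by right; split; [exact: sub2|rewrite /eball/= ltNge zr].
  apply: (le_trans (outer_measureU2 (@lebd R d) _ _)).
  by rewrite [X in (_ + X)%E]lebd_sphere// adde0.
have preE : (fun v => r u *: v) @^-1` (A `&` @eball R d (r u)) =
    [set v | A (r u *: v)] `&` @eball R d 1.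
  by rewrite preimage_setI -(eballZ d 1 r0) mulr1.
rewrite ALE LE -(lebd_scale _ r0) preE ball_probE ball_volE.
set m := lebd _.
have mfin : m \is a fin_num.
  rewrite ge0_fin_numE ?lebd_ge0//; apply: le_lt_trans (lebd_eball1_lty R d).
  by apply: le_lebd; exact: subIsetr.
have v0 := ball_vol_gt0 R d; set v := fine _ in v0 *.
have rd0 : 0 < r u ^+ d by rewrite exprn_gt0.
rewrite -(fineK mfin) -!EFinM inver mulf_eq0 !gt_eqF//= -!EFinM; congr EFin.
by field; rewrite !gt_eqF.
Qed.

Lemma slice_kernelE (A : set (Rd R d)) : measurable A ->
  @slice_kernel R d Rad phi x A =
  prod_prob (uniform_prob (@ltr01 R)) (@ball_prob R d)
    [set p : R * Rd R d | A (r p.1 *: (p.2 : 'rV[R]_d))].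
Proof.
move=> mA.
pose B := [set p : R * Rd R d | A (r p.1 *: (p.2 : 'rV[R]_d))]; rewrite -/B.
have mB : measurable B.
  rewrite -[B]setTI; exact: measurable_slice_point.
pose k (u : R) := @ball_prob R d [set v | A (r u *: (v : 'rV[R]_d))].
have kE : k = @ball_prob R d \o xsection B.
  by apply/funext => u; rewrite /k /=; congr (ball_prob _); rewrite xsectionE.
have mk : measurable_fun [set: R] k.
  rewrite kE; exact: measurable_fun_xsection.
have k0 u : (0 <= k u)%E by exact: measure_ge0.
have rho0 : 0 < rho phi x by exact: expR_gt0.
(* The product measure of [B] is the integral of the measures [k u] of its sections, and the uniform
   law on the unit interval integrates like Lebesgue measure there. *)
transitivity (\int[lebesgue_measure]_(u in `]0%R, 1%R[) k u)%E; last first.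
  transitivity (\int[uniform_prob (@ltr01 R)]_u k u)%E; last by rewrite kE.
  rewrite integral_uniform// subr0 invr1 mul1e integral_itv_bndoo//.
  exact: measurable_funTS.
rewrite /slice_kernel.
have -> : [set t : R | (0 <= t <= rho phi x)%R] = `[0%R, rho phi x]%classic.
  by apply/seteqP; split=> t; rewrite /= in_itv.
have unifE (t : R) : t \in `]0, rho phi x[ -> @unif R d Rad phi t A = k (t / rho phi x).
  rewrite in_itv/= => /andP[t0 t1].
  rewrite /k -unif_ball_prob// ?divfK ?gt_eqF//.
  by rewrite divr_gt0//= ltr_pdivrMr// mul1r.
have mkr : measurable_fun [set: R] (fun t => k (t / rho phi x)).
  by apply: measurableT_comp mk _; exact: measurable_funM.
(* [unifE] holds only for [t] strictly between 0 and [rho phi x]; the endpoints are negligible. *)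
rewrite integral_itv_bndoo; last first.
  apply: eq_measurable_fun (measurable_funTS mkr).
  by move=> t; rewrite inE => tr; rewrite unifE.
have -> : (\int[lebesgue_measure]_(t in `]0%R, rho phi x[) @unif R d Rad phi t A =
    \int[lebesgue_measure]_(t in `]0%R, rho phi x[) k (t / rho phi x)%R)%E.
  by apply: eq_integral => t; rewrite inE => tr; rewrite unifE.
rewrite ge0_integral_dilate//; last exact: measurable_funTS.
by rewrite muleA -EFinM mulVf ?mul1e// gt_eqF.
Qed.

End slice_marginal.

(** * The coupling and its cost *)

Theorem mainTheorem1 (R : realType) (d : nat) (Rad : \bar R) (phi : R -> R)
  (hRad : (0 < Rad)%E)
  (phi_incr : forall s t : R, 0 <= s -> s < t -> (t%:E < Rad)%E -> phi s < phi t)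
  (phi_conv : forall s t l : R, 0 <= s -> (s%:E < Rad)%E -> 0 <= t -> (t%:E < Rad)%E ->
     0 <= l <= 1 -> phi (l * s + (1 - l) * t) <= l * phi s + (1 - l) * phi t)
  (x y : 'rV[R]_d) (hx : ((eucl x)%:E < Rad)%E) (hy : ((eucl y)%:E < Rad)%E) :
  (wasserstein (@slice_kernel R d Rad phi x) (@slice_kernel R d Rad phi y)
    <= ((1 - (d.+1%:R)^-1) * `|eucl x - eucl y|)%:E)%E.
Proof.
pose r (z : 'rV[R]_d) (u : R) : R := slice_radius Rad phi (eucl z) (- ln u).
pose P := prod_prob (uniform_prob (@ltr01 R)) (@ball_prob R d).
pose Z (p : measurableTypeR R * Rd R d) : Rd R d * Rd R d :=
  (r x p.1 *: (p.2 : 'rV[R]_d), r y p.1 *: (p.2 : 'rV[R]_d)).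
have mZ : measurable_fun [set: measurableTypeR R * Rd R d] Z.
  by apply: measurable_fun_pair; exact: measurable_slice_point.
pose XY : {mfun (measurableTypeR R * Rd R d)%type >-> (Rd R d * Rd R d)%type} :=
  HB.pack Z (isMeasurableFun.Build _ _ _ _ _ mZ).
pose gamma : probability (Rd R d * Rd R d)%type R := distribution P XY.
have mdist : measurable_fun [set: Rd R d * Rd R d]
    (fun z : Rd R d * Rd R d => (eucl ((z.1 : 'rV[R]_d) - z.2))%:E).
  apply/measurable_EFinP.
  apply: (measurableT_comp (@measurable_eucl R d)); apply: measurable_fun_Rd => i.
  rewrite (_ : (fun t => _) = (fun z : Rd R d * Rd R d =>
    (z.1 : 'rV[R]_d) ord0 i - (z.2 : 'rV[R]_d) ord0 i)); last first.
    by apply/funext => z; rewrite !mxE.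
  by apply: measurable_funB; exact: (measurableT_comp (@measurable_coord R d i)).
apply: (@le_trans _ _ (\int[gamma]_z (eucl ((z.1 : 'rV[R]_d) - z.2))%:E)%E).
  (* Each marginal of [gamma] is the law of one component of [Z], which [slice_kernelE]
     identifies. *)
  apply: ereal_inf_lbound; exists gamma; split => // A mA; split.
    rewrite slice_kernelE// /gamma/= /distribution /pushforward.
    by congr (P _); apply/seteqP; split=> [p []|p].
  rewrite slice_kernelE// /gamma/= /distribution /pushforward.
  by congr (P _); apply/seteqP; split=> [p []|p].
rewrite ge0_integral_distribution//; last by move=> z; rewrite lee_fin eucl_ge0.
pose K : R := `|eucl x - eucl y|.
have mnorm : measurable_fun [set: measurableTypeR R * Rd R d]
    (fun p : measurableTypeR R * Rd R d => (eucl (p.2 : 'rV[R]_d))%:E).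
  by apply/measurable_EFinP; apply: (measurableT_comp (@measurable_eucl R d)).
(* The two components of [Z] are multiples of the same vector, so their distance is its norm times
   the difference of the radii, at most [K]. *)
apply: (@le_trans _ _ (\int[P]_p (K%:E * (eucl (p.2 : 'rV[R]_d))%:E))%E).
  apply: ge0_le_integral => //.
  - by move=> p _; rewrite lee_fin eucl_ge0.
  - exact: measurableT_comp mdist mZ.
  - by apply: emeasurable_funM.
  move=> p _; rewrite /= -EFinM lee_fin -scalerBl euclZ ler_wpM2r ?eucl_ge0//.
  by apply: slice_radius_lipschitz => //; exact: eucl_ge0.
rewrite ge0_integralZl//; last 2 first.
- by move=> p _; rewrite lee_fin eucl_ge0.
- by rewrite lee_fin normr_ge0.
rewrite mulrC EFinM; apply: lee_wpmul2l; first by rewrite lee_fin normr_ge0.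
(* The integrand does not depend on [u], so the outer integral is that of a constant against a
   probability. *)
rewrite [leLHS](@fubini_tonelli1 _ _ _ _ R (uniform_prob (@ltr01 R)) (@ball_prob R d) _ mnorm); last by move=> p; rewrite lee_fin eucl_ge0.
rewrite /fubini_F/= integral_cst// [X in (_ * X)%E](probability_setT _) mule1.
exact: integral_ball_prob_eucl.
Qed.
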